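(* Let $p$ be a prime number, let $\rho\in(0,\infty]$, and let $S$ be a subset of $\overline{\mathbb{Q}}\cap B(0,\rho)$ which is closed under algebraic conjugation and satisfies $0\in S$. Then there exist uncountably many $p$-adic transcendental analytic functions $f\in\mathbb{Q}_{\rho}[[z]]$ such that $S_f=S$. Moreover, if $\rho\geq 1$, then $f$ can be taken in $\mathbb{Z}_{\rho}[[z]]$.
   Context: $p$ is a fixed prime; $\mathbb{C}_p$ is the completion of an algebraic closure $\overline{\mathbb{Q}}_p$ of $\mathbb{Q}_p$, with absolute value $|\cdot|$ extending the $p$-adic absolute value normalized by $|p|=p^{-1}$. $\overline{\mathbb{Q}}\subset\mathbb{C}_p$ denotes the set of elements of $\mathbb{C}_p$ algebraic over $\mathbb{Q}$. $B(0,\rho)=\{z\in\mathbb{C}_p:|z|<\rho\}$ is the open disk, with $B(0,\infty)=\mathbb{C}_p$. For $A\subseteq\mathbb{C}_p$ and $\rho\in(0,\infty]$, $A_{\rho}[[z]]$ is the set of all power series $f(z)=\sum_{n\ge 0}a_nz^n$ with all $a_n\in A$ and with radius of convergence (exactly) $\rho$; such an $f$ is regarded as an analytic function $B(0,\rho)\to\mathbb{C}_p$. An analytic function $f:\Omega\subseteq\mathbb{C}_p\to\mathbb{C}_p$ is ($p$-adic) transcendental if the only polynomial $P(X,Y)\in\mathbb{C}_p[X,Y]$ with $P(z,f(z))=0$ for all $z\in\Omega$ is the zero polynomial. Its exceptional set is $S_f=\{\alpha\in\Omega\cap\overline{\mathbb{Q}}: f(\alpha)\in\overline{\mathbb{Q}}\}$;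 for $f\in A_\rho[[z]]$ one takes $\Omega=B(0,\rho)$. $S\subseteq\overline{\mathbb{Q}}$ is closed under algebraic conjugation if, for each $\alpha\in S$, every root in $\mathbb{C}_p$ of the minimal polynomial of $\alpha$ over $\mathbb{Q}$ belongs to $S$. *)

(* Defs.v *)
From HB Require Import structures.
From mathcomp Require Import all_boot all_order all_algebra.
(* The normed structures must not be loaded here: once PseudoMetricNormedZmod
   is declared, Hierarchy Builder rejects the join of Field and
   CompletePseudoMetric below. Loading them afterwards is harmless. *)
From mathcomp Require Import all_classical all_reals ereal topology.

Set Implicit Arguments.
Unset Strict Implicit.
Unset Printing Implicit Defensive.

Import Order.TTheory GRing.Theory Num.Theory.
Import numFieldTopology.Exports.

Local Open Scope classical_set_scope.
Local Open Scope ring_scope.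

(* The rationals and the integers, as subsets of a field of characteristic 0. *)
Definition Qset {K : fieldType} : set K := range (@ratr K).
Definition Zset {K : fieldType} : set K := range (fun m : int => m%:~R : K).

Definition algebraic_over_set {K : fieldType} (F : set K) : set K :=
  [set x | exists q : {poly K}, [/\ q != 0, forall i, F q`_i & root q x]].

Definition Qbar {K : fieldType} : set K := [set x | algebraicOver (@ratr K) x].

(* [padicComplexType R p] is the type of completions of algebraic closures of
   Q_p, with absolute value in R, for p prime. The norms of MathComp are
   archimedean (`|x *+ n| = `|x| *+ n), so the absolute value is a separate
   operation, tied to the metric structure by [pcball].
   Since the field is complete, the topological closure of Q in it is a
   completion of Q for the p-adic absolute value, i.e., Q_p; the elements
   algebraic over it form an algebraic closure of Q_p ([pcabs_closed]), which
   is dense ([pcabs_dense]). Characteristic 0 follows from [pcabs_nat] and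
   [pcabs_eq0]. *)
HB.mixin Record isPadicComplex (R : realType) (p : nat) K
    of GRing.Field K & CompletePseudoMetric R K := {
  pcabs : K -> R;
  pcabs_ge0 : forall x, 0 <= pcabs x;
  pcabs_eq0 : forall x, pcabs x = 0 <-> x = 0;
  pcabsM : forall x y, pcabs (x * y) = pcabs x * pcabs y;
  pcabsD : forall x y, pcabs (x + y) <= Num.max (pcabs x) (pcabs y);
  pcabs_nat : forall n, (0 < n)%N -> pcabs n%:R = p%:R ^- logn p n;
  pcball : forall (x : K) (e : R) (y : K), ball x e y <-> pcabs (x - y) < e;
  pcabs_closed : forall q : {poly K}, (1 < size q)%N ->
    (forall i, algebraic_over_set (closure (@Qset K)) q`_i) ->
    exists2 x, algebraic_over_set (closure (@Qset K)) x & root q x;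
  pcabs_dense : dense (algebraic_over_set (closure (@Qset K)));
}.

#[short(type="padicComplexType")]
HB.structure Definition PadicComplex (R : realType) (p : nat) :=
  {K of isPadicComplex R p K & GRing.Field K & CompletePseudoMetric R K}.

Section PadicPowerSeries.
Variables (R : realType) (p : nat) (K : padicComplexType R p).

Definition open_disk (rho : \bar R) : set K :=
  [set z | ((pcabs z)%:E < rho)%E].

Definition radius_of_convergence (a : nat -> K) : \bar R :=
  ereal_sup [set r%:E | r in
    [set r : R | 0 <= r /\ (fun n => pcabs (a n) * r ^+ n) @ \oo --> (0 : R)]].

(* The power series \sum_n a_n z^n is represented by the sequence a; this is
   A_rho[[z]]. *)
Definition power_series_over (A : set K) (rho : \bar R) : set (nat -> K) :=
  [set a | (forall n, A (a n)) /\ radius_of_convergence a = rho].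

(* Meaningful inside the disk of convergence; arbitrary where it diverges. *)
Definition ps_eval (a : nat -> K) (z : K) : K :=
  limn (fun N => \sum_(0 <= n < N) a n * z ^+ n).

Definition transcendental_on (Omega : set K) (f : K -> K) : Prop :=
  forall P : {poly {poly K}},
    (forall z, Omega z -> P.[z, f z] = 0) -> P = 0.

Definition exceptional_set (Omega : set K) (f : K -> K) : set K :=
  [set alpha | (Omega `&` Qbar) alpha /\ Qbar (f alpha)].

Definition is_minimal_polynomial (m : {poly rat}) (alpha : K) : Prop :=
  [/\ m \is monic, root (map_poly ratr m) alpha &
      forall q : {poly rat}, q != 0 -> root (map_poly ratr q) alpha ->
        (size m <= size q)%N].

Definition closed_under_conjugation (S : set K) : Prop :=
  forall alpha, S alpha -> forall m, is_minimal_polynomial m alpha ->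
    forall beta : K, root (map_poly ratr m) beta -> S beta.

End PadicPowerSeries.

(* Main.v *)
Require Import Defs.
From HB Require Import structures.
From mathcomp Require Import all_boot all_order all_algebra.
From mathcomp Require Import all_classical all_reals ereal topology.
From mathcomp Require Import sequences.
From mathcomp Require Import zify.

Set Implicit Arguments.
Unset Strict Implicit.
Unset Printing Implicit Defensive.

Import Order.TTheory GRing.Theory Num.Theory.
Import numFieldTopology.Exports.

Local Open Scope classical_set_scope.
Local Open Scope ring_scope.

(** The series is assembled from blocks: [f = \sum_n T_n] with [T_n] a rational
    polynomial of the form [c_n * X^(k_n) * q_n]. Here [q_n] is the product of
    the minimal polynomials of the first elements [s_0, ..., s_n] of an
    enumeration of [S], and each [k_n] is much larger than the degree of what
    precedes it. On [S] all but finitely many blocks vanish, so [f] has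
    algebraic values there. Everything else is arranged by the choice of [k_n]
    and [c_n].

    - Off [S]: the pairs [(alpha_n, beta_n)] of algebraic numbers are countably
      many. If [alpha_n] is in the disk but not in [S], then neither [X] (as
      [0] is in [S]) nor [q_n] vanishes at it, and a suitable [c_n] makes the
      partial sum after step [n] differ from [beta_n] at [alpha_n]. Later blocks
      are smaller at [alpha_n] than the distance so obtained, because
      [|alpha_n|] is less than the radius and their [k_m] is large. By the
      ultrametric inequality, that distance never changes ([pcabsD_id]).
    - Radius: all roots of [q_n] are in [S], which is closed under conjugation,
      hence they are in the disk. So the leading coefficient of [q_n] dominates
      the others on circles whose radius bounds the roots
      ([pcabs_coef_prod_XsubC]). Scaling the block by a power of [p] brings its
      norm on such a circle between [1/p] and [1] ([rational_scale]). The radii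
      of these circles are [rho] itself if [rho] is finite, and tend to infinity
      otherwise ([radii_exist]); the radius of convergence is then exactly
      [rho] ([limit_radius]).
    - Integrality: if the circles have radius at least [1], the coefficients are
      [p]-integral, and their denominators are [p]-adic units, which can be
      cleared without changing absolute values ([clear_denominators]).
    - Transcendence: the gaps between blocks outgrow the degrees of the partial
      sums [f_n]. If [P(z, f(z)) = 0], then [P(z, f_n(z))] is a polynomial that
      vanishes at [0] to an order above its degree, so each of the infinitely
      many [f_n] is a root of [P(z, Y)], and [P = 0]
      ([lacunary_transcendental]).
    - Uncountability: the choice of [c_n] also makes the leading coefficient of
      [T_n], which is a coefficient of [f], differ from the one of the [n]-th
      term of a given sequence of series ([uncountable_diagonal]). *)

(** * The absolute value *)

Section AbsoluteValue.
Variables (R : realType) (p : nat) (K : padicComplexType R p).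
Implicit Types (x y z : K) (e r : R).

Lemma pcabs0 : pcabs (0 : K) = 0.
Proof. exact/pcabs_eq0. Qed.

Lemma pcabs_neq0 x : (pcabs x != 0) = (x != 0).
Proof. by congr negb; apply/eqP/eqP => /pcabs_eq0. Qed.

Lemma pcabs_gt0 x : (0 < pcabs x) = (x != 0).
Proof. by rewrite lt0r pcabs_neq0 pcabs_ge0 andbT. Qed.

Lemma pcabs1 : pcabs (1 : K) = 1.
Proof. by rewrite -[1 in LHS]/(1%:R) pcabs_nat // logn1 expr0 invr1. Qed.

Lemma pcabsN x : pcabs (- x) = pcabs x.
Proof.
have h : pcabs (-1 : K) = 1.
  apply/eqP; rewrite -(@eqrXn2 _ 2) ?pcabs_ge0 //.
  by rewrite expr2 -pcabsM mulrNN mulr1 pcabs1 expr1n.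
by rewrite -mulN1r pcabsM h mul1r.
Qed.

Lemma pcabsX x n : pcabs (x ^+ n) = pcabs x ^+ n.
Proof. by elim: n => [|n IH]; rewrite ?expr0 ?pcabs1 // !exprS pcabsM IH. Qed.

Lemma pcabsV x : pcabs x^-1 = (pcabs x)^-1.
Proof.
have [->|x0] := eqVneq x 0; first by rewrite invr0 pcabs0 invr0.
apply: (@mulfI _ (pcabs x)); first by rewrite pcabs_neq0.
by rewrite -pcabsM !divff ?pcabs1 ?pcabs_neq0.
Qed.

Lemma pcabs_distC x y : pcabs (x - y) = pcabs (y - x).
Proof. by rewrite -pcabsN opprB. Qed.

Lemma pcabsD_le x y e : pcabs x <= e -> pcabs y <= e -> pcabs (x + y) <= e.
Proof. by move=> hx hy; rewrite (le_trans (pcabsD x y)) // ge_max hx. Qed.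

Lemma pcabsB_le x y e : pcabs x <= e -> pcabs y <= e -> pcabs (x - y) <= e.
Proof. by move=> hx hy; apply: pcabsD_le; rewrite ?pcabsN. Qed.

Lemma pcabsD_lt x y e : pcabs x < e -> pcabs y < e -> pcabs (x + y) < e.
Proof. by move=> hx hy; rewrite (le_lt_trans (pcabsD x y)) // gt_max hx. Qed.

(** This makes every inequality [f alpha != beta] permanent, once a partial sum
    has achieved it: the later blocks are smaller at [alpha] than the distance
    of the two sides. *)
Lemma pcabsD_id x y : pcabs y < pcabs x -> pcabs (x + y) = pcabs x.
Proof.
move=> hyx; apply/eqP; rewrite eq_le pcabsD_le ?(ltW hyx) //= leNgt.
apply/negP => h.
have := pcabsD_lt h (_ : pcabs (- y) < pcabs x).
by rewrite addrK ltxx pcabsN => /(_ hyx).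
Qed.

Lemma pcabs_sum_le (I : Type) (s : seq I) (P : pred I) (F : I -> K) e :
  0 <= e -> (forall i, P i -> pcabs (F i) <= e) ->
  pcabs (\sum_(i <- s | P i) F i) <= e.
Proof.
move=> e0 h; elim/big_ind: _ => //; first by rewrite pcabs0.
by move=> x y; exact: pcabsD_le.
Qed.

Lemma pcabs_nat_le1 n : pcabs (n%:R : K) <= 1.
Proof.
by elim: n => [|n IH]; rewrite ?pcabs0 // -addn1 natrD pcabsD_le // pcabs1.
Qed.

Lemma natrK_eq0 n : ((n%:R : K) == 0) = (n == 0)%N.
Proof.
case: n => [|n]; first by rewrite !eqxx.
apply/negbTE; rewrite -pcabs_neq0 pcabs_nat // invr_eq0 expf_eq0 negb_and.
have [->|p_gt0] := posnP p; first by rewrite lognE.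
by rewrite pnatr_eq0 -lt0n p_gt0 orbT.
Qed.

Lemma natrK_inj : injective (fun n => n%:R : K).
Proof.
suff H m n : (m <= n)%N -> m%:R = n%:R :> K -> m = n.
  by move=> m n h; case: (leqP m n) => [/H|/ltnW/H/(_ (esym h))]; first exact.
move=> mn /esym/eqP; rewrite -subr_eq0 -natrB // natrK_eq0 => /eqP; lia.
Qed.

(** A name of its own lets [ratr] carry a ring morphism structure into [K],
    which has characteristic 0 without being an ordered field. *)
Definition ratK : rat -> K := @ratr K.

Lemma intrK_eq0 (m : int) : ((m%:~R : K) == 0) = (m == 0).
Proof.
by case: m => n; rewrite ?NegzE ?mulrNz ?oppr_eq0 ?pmulrn natrK_eq0.
Qed.

Lemma ratKE (x : rat) (a b : int) : b != 0 -> x = a%:~R / b%:~R ->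
  ratK x = a%:~R / b%:~R.
Proof.
move=> b0 xE; rewrite /ratK /ratr.
have d0 : (denq x)%:~R != 0 :> K by rewrite intrK_eq0 denq_neq0.
have b0' : b%:~R != 0 :> K by rewrite intrK_eq0.
apply/eqP; rewrite eqr_div // -!intrM; apply/eqP; congr (_%:~R).
apply: (@intr_inj rat); rewrite !intrM; apply/eqP.
by rewrite -eqr_div ?intr_eq0 ?denq_neq0 // divq_num_den xE.
Qed.

Fact ratK_is_zmod_morphism : zmod_morphism ratK.
Proof.
have nz (w : rat) : (denq w)%:~R != 0 :> K by rewrite intrK_eq0 denq_neq0.
have nzq (w : rat) : (denq w)%:~R != 0 :> rat by rewrite intr_eq0 denq_neq0.
move=> x y.
rewrite (@ratKE (x - y) (numq x * denq y - numq y * denq x) (denq x * denq y)).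
- by rewrite intrB !intrM /ratK /ratr -[- (_ / _)]mulNr addf_div // mulNr.
- by rewrite mulf_neq0 ?denq_neq0.
rewrite -{1}[x]divq_num_den -{1}[y]divq_num_den intrB !intrM.
by rewrite -[- (_ / _)]mulNr addf_div // mulNr.
Qed.

Fact ratK_is_monoid_morphism : monoid_morphism ratK.
Proof.
split=> [|x y]; first by rewrite /ratK /ratr divr1.
rewrite (@ratKE (x * y) (numq x * numq y) (denq x * denq y)).
- by rewrite /ratK /ratr mulf_div !intrM.
- by rewrite mulf_neq0 ?denq_neq0.
by rewrite -{1}[x]divq_num_den -{1}[y]divq_num_den mulf_div !intrM.
Qed.

HB.instance Definition _ := GRing.isZmodMorphism.Build rat K ratK
  ratK_is_zmod_morphism.
HB.instance Definition _ := GRing.isMonoidMorphism.Build rat K ratK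
  ratK_is_monoid_morphism.

End AbsoluteValue.
Arguments ratK {R p K}.

(** * Rational numbers and algebraic numbers in the field *)

Section Algebraic.
Variables (R : realType) (p : nat) (K : padicComplexType R p).
Implicit Types (x y z : K).

Lemma pcabs_nat_eq1 n : ~~ (p %| n)%N -> pcabs (n%:R : K) = 1.
Proof.
case: n => [|n]; first by rewrite dvdn0.
by move=> pn; rewrite pcabs_nat // lognE (negbTE pn) !andbF expr0 invr1.
Qed.

Hypothesis p_prime : prime p.

Lemma pcabs_prime : pcabs (p%:R : K) = p%:R^-1.
Proof. by rewrite pcabs_nat ?prime_gt0 // logn_prime // eqxx expr1. Qed.

Lemma invp_lt1 : (p%:R^-1 : R) < 1.
Proof. by rewrite invf_lt1 ?ltr0n ?ltr1n ?prime_gt0 ?prime_gt1. Qed.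

Lemma pcabs_denq (c : rat) : pcabs (ratK c : K) <= 1 ->
  pcabs ((denq c)%:~R : K) = 1.
Proof.
move=> c1; have [dE n_dE] : denq c = `|denq c|%N%:Z /\ (0 < `|denq c|)%N.
  by rewrite absz_denq absz_gt0 denq_neq0.
rewrite dE -[LHS]/(pcabs (`|denq c|%N%:R : K)).
have [pd|] := boolP (p %| `|denq c|)%N; last exact: pcabs_nat_eq1.
have pn : ~~ (p %| `|numq c|)%N.
  apply/negP => pn; have := coprime_num_den c.
  rewrite /coprime => /eqP g1.
  by have := dvdn_gcd p `|numq c| `|denq c|; rewrite g1 pn pd Euclid_dvd1.
have n1 : pcabs ((numq c)%:~R : K) = 1.
  rewrite [numq c]intEsg rmorphM /= pcabsM [X in _ * X]pcabs_nat_eq1 // mulr1.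
  by case: sgzP pn => [->|_|_]; rewrite ?rmorphN ?pcabsN ?pcabs1 ?absz0 ?dvdn0.
have d_lt1 : pcabs (`|denq c|%N%:R : K) < 1.
  rewrite -(divnK pd) natrM pcabsM pcabs_prime.
  rewrite (le_lt_trans _ invp_lt1) // ler_piMl ?invr_ge0 ?ler0n //.
  exact: pcabs_nat_le1.
have d_gt0 : 0 < pcabs (`|denq c|%N%:R : K).
  by rewrite pcabs_gt0 natrK_eq0 -lt0n.
move: c1; rewrite /ratK /ratr pcabsM pcabsV n1 mul1r dE.
by rewrite invf_le1 // leNgt => /negP.
Qed.

(** The denominators of [p]-integral coefficients are [p]-adic units, so they
    can be cleared without any effect on absolute values. *)
Lemma clear_denominators (T : {poly rat}) :
    (forall j, pcabs (ratK T`_j : K) <= 1) ->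
  exists d : int, pcabs (d%:~R : K) = 1 /\
    forall j, exists m : int, d%:~R * T`_j = m%:~R.
Proof.
move=> T1; exists (\prod_(j < size T) denq T`_j); split.
  rewrite rmorph_prod /=; elim/big_rec: _ => [|i y _ IH]; first exact: pcabs1.
  by rewrite pcabsM IH mulr1 pcabs_denq.
move=> j; have [jT|Tj] := ltnP j (size T); last first.
  by exists 0; rewrite nth_default // mulr0.
rewrite (bigD1 (Ordinal jT)) //= rmorphM /= mulrAC [_%:~R * T`_j]mulrC -numqE.
by rewrite -rmorphM; eexists.
Qed.

Lemma QbarE x : Qbar x = integralOver (@ratK R p K) x.
Proof. by apply/propext; exact: (integral_algebraic (@ratK R p K) x). Qed.

Lemma QbarD x y : Qbar x -> Qbar y -> Qbar (x + y).
Proof. exact: (@algebraic_add _ _ (@ratK R p K)). Qed.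

Lemma QbarM x y : Qbar x -> Qbar y -> Qbar (x * y).
Proof. exact: (@algebraic_mul _ _ (@ratK R p K)). Qed.

Lemma Qbar_rat (c : rat) : Qbar (ratK c : K).
Proof. exact: (@algebraic_id _ _ (@ratK R p K)). Qed.

Lemma Qbar_horner (q : {poly rat}) x : Qbar x -> Qbar (map_poly ratK q).[x].
Proof.
move=> xA; elim/poly_ind: q => [|q c IH].
  by rewrite rmorph0 horner0 -(rmorph0 (@ratK R p K)); exact: Qbar_rat.
rewrite rmorphD rmorphM /= map_polyX map_polyC hornerMXaddC.
by apply: QbarD; [exact: QbarM | exact: Qbar_rat].
Qed.

(** Being algebraic is transitive: the root given by [pcabs_closed] is algebraic
    over [Qbar], hence over the rational numbers. *)
Lemma Qbar_root (q : {poly K}) : (1 < size q)%N -> (forall i, Qbar q`_i) ->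
  exists2 x, Qbar x & root q x.
Proof.
move=> q1 qA; have [|x _ qx] := pcabs_closed q q1.
  move=> i; have [r rN rx] := qA i; exists (map_poly (@ratK R p K) r).
  split=> //; first by rewrite map_poly_eq0.
  by move=> j; rewrite coef_map; apply: subset_closure; eexists.
exists x => //; rewrite QbarE; apply: (integral_root _ qx).
  by rewrite -size_poly_gt0 ltnW.
by move=> c /(nthP 0) [i _ <-]; rewrite -QbarE.
Qed.

(** One root at a time. The quotient by ['X - x%:P] again has algebraic
    coefficients: from the top one down, they arise from [x] and the
    coefficients of [q] by sums and products. *)
Lemma Qbar_split (q : {poly K}) : q \is monic -> (forall i, Qbar q`_i) ->
  exists s : seq K, q = \prod_(x <- s) ('X - x%:P).
Proof.
have [n] := ubnP (size q); elim: n q => // n IH q /ltnSE qn qm qA.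
have [q1|q1] := leqP (size q) 1.
  exists nil; rewrite big_nil; move: qm; rewrite (size1_polyC q1) monicE.
  by rewrite lead_coefC => /eqP ->.
have [x xA /factor_theorem [q' qE]] := Qbar_root q1 qA.
have q'm : q' \is monic by move: qm; rewrite qE monicMr ?monicXsubC.
have sq : size q = (size q').+1.
  by rewrite qE size_Mmonic ?monicXsubC ?monic_neq0 // size_XsubC addn2.
have coefq i : q'`_i = q`_i.+1 + x * q'`_i.+1.
  by rewrite qE mulrBr coefB coefMX coefMC mulrC subrK.
have q'A i : Qbar q'`_i.
  have [k] := ubnP (size q - i); elim: k i => // k IHk i ik.
  have [iq|qi] := ltnP i (size q).
    by rewrite coefq; apply: QbarD => //; apply: QbarM => //; apply: IHk; lia.
  rewrite nth_default; last by rewrite -ltnS -sq (leq_trans qi).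
  by rewrite -(rmorph0 (@ratK R p K)); exact: Qbar_rat.
have [|s q'E] := IH q' _ q'm q'A; first by rewrite -ltnS -sq ltnS.
by exists (x :: s); rewrite big_cons -q'E mulrC.
Qed.

Lemma minimal_polynomial_exists x : Qbar x ->
  exists m, is_minimal_polynomial m x.
Proof.
move=> [q0 q0N q0x].
pose P n := `[< exists q : {poly rat},
  [/\ q != 0, root (map_poly ratr q) x & size q = n] >].
have exP : exists n, P n by exists (size q0); apply/asboolP; exists q0.
case: (ex_minnP exP) => n /asboolP [q [qN qx <-]] qmin.
have lN : (lead_coef q)^-1 != 0 by rewrite invr_eq0 lead_coef_eq0.
exists ((lead_coef q)^-1 *: q); split.
- by rewrite monicE lead_coefZ mulVf // lead_coef_eq0.
- rewrite -[map_poly _]/(map_poly (@ratK R p K)) map_polyZ rootZ //.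
  by rewrite fmorph_eq0.
- move=> q' q'N q'x; rewrite size_scale //; apply: qmin.
  by apply/asboolP; exists q'.
Qed.

(** This is where closure under conjugation enters: a rational polynomial that
    vanishes at [x] vanishes at the conjugates of [x] too, and its size can be
    controlled only if these stay in the disk. *)
Lemma conjugates_polynomial (S : set K) x :
    S `<=` Qbar -> closed_under_conjugation S -> S x ->
  exists m : {poly rat}, exists s : seq K,
    [/\ map_poly ratK m = \prod_(y <- s) ('X - y%:P), x \in s &
        forall y, y \in s -> S y].
Proof.
move=> SA Sc Sx; have [m mx] := minimal_polynomial_exists (SA _ Sx).
have [mm rx _] := mx.
have [||s sE] := @Qbar_split (map_poly ratK m).
- by rewrite map_monic.
- by move=> i; rewrite coef_map; exact: Qbar_rat.
exists m, s; split => //.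
  by rewrite -root_prod_XsubC -sE.
by move=> y; rewrite -root_prod_XsubC -sE; apply: Sc mx _.
Qed.

End Algebraic.

(** * Convergence *)

Section Convergence.
Variables (R : realType) (p : nat) (K : padicComplexType R p).
Implicit Types (x y z : K) (e r : R) (u v : nat -> K).

Definition vanishing (w : nat -> R) :=
  forall e, 0 < e -> exists N, forall n, (N <= n)%N -> w n < e.

Lemma cvg0_vanishing (w : nat -> R) : (forall n, 0 <= w n) ->
  (w @ \oo --> (0 : R)) <-> vanishing w.
Proof.
move=> w0; split=> [/cvg_ballP wc e e0|wv].
  have [N _ NP] := wc e e0; exists N => n Nn.
  by have := NP n Nn; rewrite /ball /= sub0r normrN ger0_norm.
apply/cvg_ballP => e e0; have [N NP] := wv e e0; exists N => // n Nn.
by rewrite /ball /= sub0r normrN ger0_norm // NP.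
Qed.

Lemma vanishing_le (w w' : nat -> R) (N : nat) :
  (forall n, (N <= n)%N -> w' n <= w n) -> vanishing w -> vanishing w'.
Proof.
move=> ww' wv e e0; have [N' N'P] := wv e e0; exists (maxn N N') => n.
by rewrite geq_max => /andP [? ?]; rewrite (le_lt_trans (ww' _ _)) // N'P.
Qed.

Lemma vanishing_bounded (w : nat -> R) : vanishing w ->
  exists2 B, 0 < B & forall n, w n <= B.
Proof.
move=> /(_ 1 ltr01) [N NP].
have [B B0 BP] : exists2 B, 0 < B & forall n, (n < N)%N -> w n <= B.
  elim: {NP} N => [|N [B B0 BP]]; first by exists 1.
  exists (Num.max B (w N)); first by rewrite lt_max B0.
  move=> n; rewrite ltnS leq_eqVlt le_max => /predU1P [->|/BP ->//].
  by rewrite lexx orbT.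
exists (Num.max 1 B); first by rewrite lt_max ltr01.
move=> n; rewrite le_max; case: (ltnP n N) => [/BP ->|/NP/ltW ->//].
by rewrite orbT.
Qed.

Lemma vanishing_expr r : 0 <= r -> r < 1 -> vanishing (fun n => r ^+ n).
Proof.
move=> r0 r1; apply/cvg0_vanishing => [n|]; first exact: exprn_ge0.
by apply: cvg_expr; rewrite ger0_norm.
Qed.

Definition converges_to u x := vanishing (fun n => pcabs (u n - x)).

Lemma converges_limn u x : converges_to u x -> limn u = x.
Proof.
move=> ux; apply: cvg_lim.
  rewrite ball_hausdorff => a b ab.
  have d0 : 0 < pcabs (a - b) by rewrite pcabs_gt0 subr_eq0.
  exists (PosNum d0, PosNum d0) => /=; apply/eqP; rewrite -subset0 => y [].
  move=> /pcball ay /pcball /= yb.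
  have := pcabsD_lt ay (_ : pcabs (y - b) < _).
  by rewrite addrA subrK ltxx pcabs_distC => /(_ yb).
apply/cvg_ballP => e e0; have [N NP] := ux e e0.
by exists N => // n Nn; apply/pcball; rewrite pcabs_distC; exact: NP.
Qed.

Lemma converges_lt u x y e (N : nat) : converges_to u x ->
  (forall n, (N <= n)%N -> pcabs (u n - y) < e) -> pcabs (x - y) < e.
Proof.
move=> ux uy; have e0 : 0 < e by apply: le_lt_trans (uy N _);
  rewrite ?pcabs_ge0.
have [N' N'P] := ux e e0.
have := pcabsD_lt (_ : pcabs (x - u (maxn N N')) < e) (uy _ (leq_maxl N N')).
by rewrite addrA subrK pcabs_distC; apply; apply: N'P; exact: leq_maxr.
Qed.

Lemma converges_le u x y e (N : nat) : converges_to u x ->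
  (forall n, (N <= n)%N -> pcabs (u n - y) <= e) -> pcabs (x - y) <= e.
Proof.
move=> ux uy; rewrite leNgt; apply/negP => h.
have := converges_lt ux (fun n Nn => le_lt_trans (uy n Nn) h).
by rewrite ltxx.
Qed.

(** The ultrametric inequality bounds the difference of two partial sums by the
    largest term between them, so that the partial sums are Cauchy. *)
Lemma series_converges (t : nat -> K) : vanishing (fun n => pcabs (t n)) ->
  converges_to (fun N => \sum_(0 <= n < N) t n)
               (limn (fun N => \sum_(0 <= n < N) t n)).
Proof.
move=> tv; set u := (fun N => _).
have uc N M e : 0 < e -> (N <= M)%N ->
    (forall n, (N <= n)%N -> pcabs (t n) <= e) -> pcabs (u M - u N) <= e.
  move=> e0 NM tN; rewrite /u (big_cat_nat (leq0n N) NM) /=.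
  rewrite [X in X - _]addrC addrK.
  rewrite big_nat_cond; apply: pcabs_sum_le => [|n]; first exact: ltW.
  by move=> /andP [/andP [/tN]].
have cu : cvg (u @ \oo).
  apply/cauchy_cvgP/cauchy_exP => e e0.
  have e2 : 0 < e / 2 by rewrite divr_gt0.
  have [N NP] := tv _ e2; exists (u N); exists N => // n Nn; apply/pcball.
  rewrite pcabs_distC (@le_lt_trans _ _ (e / 2)) //; last first.
    by rewrite ltr_pdivrMr // ltr_pMr // ltr1n.
  by apply: uc => // k /NP/ltW.
have [l ul] : exists l, converges_to u l.
  have /cvg_ballP h := cu; exists (limn u) => e e0.
  have [N _ NP] := h e e0; exists N => n Nn.
  by rewrite pcabs_distC; apply/pcball; exact: NP.
by rewrite (converges_limn ul).
Qed.
End Convergence.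

(** * Estimates for polynomials *)

Lemma finitely_many_roots (D : idomainType) (q : {poly D}) : q != 0 ->
  exists s : seq D, forall x, root q x -> x \in s.
Proof.
have [n] := ubnP (size q); elim: n q => // n IH q /ltnSE qn q0.
have [[x /factor_theorem [q' qE]]|nor] := EM (exists x, root q x); last first.
  by exists nil => x qx; case: nor; exists x.
have q'0 : q' != 0 by apply: contraNneq q0 => h; rewrite qE h mul0r.
have [|s sP] := IH q' _ q'0.
  apply: leq_trans qn.
  by rewrite qE size_Mmonic ?monicXsubC // size_XsubC addn2.
exists (x :: s) => y; rewrite qE rootM root_XsubC inE => /orP [/sP ->|->//].
by rewrite orbT.
Qed.

Section PolynomialEstimates.
Variables (R : realType) (p : nat) (K : padicComplexType R p).
Implicit Types (x y z : K) (e r : R).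

(** The largest [|q_j| r^j] is the Gauss norm of [q]; a factor ['X - x%:P] with
    [|x| <= r] multiplies it by at most [r]. *)
Lemma pcabs_coef_prod_XsubC (s : seq K) r j : 0 <= r ->
    (forall x, x \in s -> pcabs x <= r) ->
  pcabs (\prod_(x <- s) ('X - x%:P))`_j * r ^+ j <= r ^+ size s.
Proof.
move=> r0; elim: s j => [|x s IH] j sr.
  rewrite big_nil coef1; case: j => [|j]; first by rewrite pcabs1 mulr1.
  by rewrite pcabs0 mul0r.
have {}IH k : pcabs (\prod_(y <- s) ('X - y%:P))`_k * r ^+ k <= r ^+ size s.
  by apply: IH => y ys; apply: sr; rewrite inE ys orbT.
have xr : pcabs x <= r by apply: sr; rewrite inE eqxx.
rewrite big_cons mulrBl coefB coefCM /= -{1}[r]ger0_norm //.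
set q := \prod_(y <- s) _ in IH *.
have rj : pcabs ('X * q)`_j * r ^+ j <= r ^+ (size s).+1.
  rewrite coefXM; case: j => [|j] /=; first by rewrite pcabs0 mul0r exprn_ge0.
  by rewrite !exprS mulrCA ler_wpM2l.
have xq : pcabs (x * q`_j) * r ^+ j <= r ^+ (size s).+1.
  by rewrite pcabsM -mulrA exprS ler_pM ?mulr_ge0 ?pcabs_ge0 ?exprn_ge0.
rewrite ger0_norm // (le_trans (ler_wpM2r _ (pcabsD _ _))) ?exprn_ge0 //.
by rewrite pcabsN maxr_pMl ?exprn_ge0 // ge_max rj.
Qed.

Lemma pcabs_horner_prod_XsubC (s : seq K) r z : pcabs z <= r ->
    (forall x, x \in s -> pcabs x <= r) ->
  pcabs (\prod_(x <- s) ('X - x%:P)).[z] <= r ^+ size s.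
Proof.
move=> zr; elim: s => [|x s IH] sr; first by rewrite big_nil hornerC pcabs1.
rewrite big_cons hornerM pcabsM exprS ler_pM ?pcabs_ge0 //.
  by rewrite hornerXsubC pcabsB_le // sr // inE eqxx.
by apply: IH => y ys; apply: sr; rewrite inE ys orbT.
Qed.

Lemma horner_bounded (h : {poly K}) (B : R) : 0 <= B ->
  exists2 C, 0 <= C & forall z, pcabs z <= B -> pcabs h.[z] <= C.
Proof.
move=> B0; elim/poly_ind: h => [|h c [C C0 CP]].
  by exists 0 => // z _; rewrite horner0 pcabs0.
exists (Num.max (C * B) (pcabs c)); first by rewrite le_max pcabs_ge0 orbT.
move=> z zB; rewrite hornerMXaddC (le_trans (pcabsD _ _)) //.
rewrite ge_max !le_max lexx orbT andbT pcabsM.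
by rewrite ler_pM ?pcabs_ge0 ?CP.
Qed.

Lemma horner2_bounded (Q : {poly {poly K}}) (B : R) : 0 <= B ->
  exists2 C, 0 <= C &
    forall u z, pcabs u <= B -> pcabs z <= B -> pcabs Q.[u, z] <= C.
Proof.
move=> B0; elim/poly_ind: Q => [|Q c [C C0 CP]].
  by exists 0 => // u z _ _; rewrite !horner0 pcabs0.
have [C' C'0 C'P] := horner_bounded c B0.
exists (Num.max (C * B) C'); first by rewrite le_max C'0 orbT.
move=> u z uB zB; rewrite hornerMXaddC hornerD hornerM hornerC.
rewrite (le_trans (pcabsD _ _)) // ge_max !le_max C'P // orbT andbT pcabsM.
by rewrite ler_pM ?pcabs_ge0 ?CP.
Qed.

(** It serves to compare [P(z, f(z))] with [P(z, f_n(z))] for a truncation [f_n]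
    of [f]. *)
Lemma horner2_lipschitz (Q : {poly {poly K}}) (B : R) : 0 <= B ->
  exists2 C, 0 <= C & forall u v z, pcabs u <= B -> pcabs v <= B ->
    pcabs z <= B -> pcabs (Q.[u, z] - Q.[v, z]) <= C * pcabs (u - v).
Proof.
move=> B0; elim/poly_ind: Q => [|Q c [C C0 CP]].
  by exists 0 => // u v z _ _ _; rewrite !horner0 subr0 pcabs0 mul0r.
have [C' C'0 C'P] := horner2_bounded Q B0.
exists (Num.max (C * B) C'); first by rewrite le_max C'0 orbT.
move=> u v z uB vB zB; rewrite !hornerMXaddC !hornerD !hornerM !hornerC.
rewrite opprD addrACA subrr addr0.
have -> : Q.[u, z] * u - Q.[v, z] * v =
    (Q.[u, z] - Q.[v, z]) * u + Q.[v, z] * (u - v).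
  by rewrite mulrBl mulrBr addrA subrK.
rewrite maxr_pMl ?pcabs_ge0 // (le_trans (pcabsD _ _)) // ge_max !le_max.
rewrite !pcabsM [C' * _ in X in _ || X]mulrC [_ * C' in X in _ || X]mulrC.
rewrite [C * B * _]mulrAC ler_pM ?pcabs_ge0 ?CP //=.
by rewrite ler_wpM2r ?pcabs_ge0 ?C'P ?orbT.
Qed.

Lemma horner_hornerC (Q : {poly {poly K}}) (h : {poly K}) z :
  (Q.[h]).[z] = Q.[h.[z], z].
Proof.
elim/poly_ind: Q => [|Q c IH]; first by rewrite !horner0.
by rewrite !hornerMXaddC !hornerD !hornerM hornerC IH.
Qed.

Lemma size_horner2_le (Q : {poly {poly K}}) :
  exists c, forall h : {poly K}, (size Q.[h] <= c * (size h).+1)%N.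
Proof.
elim/poly_ind: Q => [|Q c [k kP]].
  by exists 0%N => h; rewrite horner0 size_poly0.
exists (k + size c + 1)%N => h; rewrite hornerMXaddC.
rewrite (leq_trans (size_polyD _ _)) // geq_max; apply/andP; split.
  rewrite (leq_trans (size_polyMleq _ _)) // (leq_trans (leq_pred _)) //.
  rewrite !mulnDl -addnA leq_add // mul1n (leq_trans (leqnSn _)) //.
  exact: leq_addl.
rewrite (leq_trans (leq_pmulr _ (ltn0Sn (size h)))) // leq_mul //.
by rewrite -addnA addnCA leq_addr.
Qed.

Hypothesis p_prime : prime p.

Lemma small_element e : 0 < e -> exists2 z : K, z != 0 & pcabs z < e.
Proof.
move=> e0; have [|N NP] := vanishing_expr _ (invp_lt1 R p_prime) e0.
  by rewrite invr_ge0.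
exists (p%:R ^+ N); first by rewrite expf_neq0 // natrK_eq0 -lt0n prime_gt0.
by rewrite pcabsX pcabs_prime // NP.
Qed.

(** Near 0 a polynomial is dominated by its lowest nonzero term, of order at
    most its degree. The induction removes factors ['X]: for small [z], the
    bound leaves no room for a nonzero constant coefficient. *)
Lemma small_poly_eq0 (h : {poly K}) (M : nat) (C r : R) : 0 < r -> 0 <= C ->
    (size h <= M)%N ->
    (forall z, z != 0 -> pcabs z <= r -> pcabs h.[z] <= C * pcabs z ^+ M) ->
  h = 0.
Proof.
move=> r0 C0; elim: M h => [|M IH] h.
  by rewrite leqn0 size_poly_eq0 => /eqP.
elim/poly_ind: h => // h c _ sh hC.
have [B B0 BP] := horner_bounded h (ltW r0).
have c0 : c = 0.
  apply/eqP; rewrite -[_ == _]negbK -pcabs_gt0; apply/negP => c0.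
  pose e := Num.min (Num.min r 1) (pcabs c / (B + C + 1)).
  have BC : 0 < B + C + 1 by rewrite ltr_wpDl ?addr_ge0.
  have e0 : 0 < e by rewrite !lt_min r0 ltr01 divr_gt0.
  have [z z0] := small_element e0; rewrite !lt_min => /andP [/andP [zr z1] zc].
  have := hC z z0 (ltW zr); rewrite hornerMXaddC => hz.
  have : pcabs c <= (B + C) * pcabs z.
    rewrite -[c](addKr (h.[z] * z)) addrC mulrDl.
    have C1 : C * pcabs z ^+ M.+1 <= C * pcabs z.
      rewrite ler_wpM2l // exprS ler_piMr ?pcabs_ge0 //.
      rewrite exprn_ile1 ?pcabs_ge0 //.
      exact: ltW.
    apply: pcabsB_le.
      by rewrite (le_trans hz) // (le_trans C1) // lerDr mulr_ge0 ?pcabs_ge0.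
    rewrite pcabsM (@le_trans _ _ (B * pcabs z)) ?ler_wpM2r ?pcabs_ge0 ?BP //.
      exact: ltW.
    by rewrite lerDl mulr_ge0 ?pcabs_ge0.
  move=> cz; have : (B + C + 1) * pcabs z < pcabs c.
    by rewrite mulrC -ltr_pdivlMr.
  by rewrite ltNge (le_trans cz) // [leRHS]mulrDl mul1r lerDl pcabs_ge0.
move: sh hC; rewrite c0 addr0 => sh hC; rewrite (IH h) ?mul0r //.
  have [->|h0] := eqVneq h 0; first by rewrite size_poly0.
  by move: sh; rewrite size_mulX.
move=> z z0 zr; have := hC z z0 zr; rewrite hornerMX pcabsM exprSr mulrA.
by rewrite ler_pM2r ?pcabs_gt0.
Qed.

End PolynomialEstimates.

(** * Lacunary power series are transcendental *)

Section PowerSeries.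
Variables (R : realType) (p : nat) (K : padicComplexType R p).
Implicit Types (a : nat -> K) (x y z : K) (e r : R).

Definition truncation a n : {poly K} := \poly_(j < n) a j.

Lemma horner_truncation a n z :
  (truncation a n).[z] = \sum_(0 <= j < n) a j * z ^+ j.
Proof. by rewrite horner_poly big_mkord. Qed.

Lemma truncation_converges a r z : pcabs z <= r ->
    vanishing (fun n => pcabs (a n) * r ^+ n) ->
  converges_to (fun n => (truncation a n).[z]) (ps_eval a z).
Proof.
move=> zr av; under eq_fun do rewrite horner_truncation.
apply: series_converges; apply: (vanishing_le (N := 0%N)) av => n _.
rewrite pcabsM pcabsX ler_wpM2l ?pcabs_ge0 //.
by rewrite lerXn2r ?nnegrE ?pcabs_ge0 // (le_trans _ zr) ?pcabs_ge0.
Qed.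

Lemma truncation_bounded a r B n z : 0 <= B -> pcabs z <= r ->
    (forall j, pcabs (a j) * r ^+ j <= B) ->
  pcabs (truncation a n).[z] <= B.
Proof.
move=> B0 zr aB; rewrite horner_truncation; apply: pcabs_sum_le => // j _.
rewrite (le_trans _ (aB j)) // pcabsM pcabsX ler_wpM2l ?pcabs_ge0 //.
by rewrite lerXn2r ?nnegrE ?pcabs_ge0 // (le_trans _ zr) ?pcabs_ge0.
Qed.

(** The omitted nonzero terms have degree at least [M], and the one of degree
    [j] is at most [B * (|z| / r)^j]. *)
Lemma truncation_tail a r B n M z : 0 < r -> 0 <= B -> pcabs z <= r ->
    vanishing (fun j => pcabs (a j) * r ^+ j) ->
    (forall j, pcabs (a j) * r ^+ j <= B) ->
    (forall j, (n <= j < M)%N -> a j = 0) ->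
  pcabs (ps_eval a z - (truncation a n).[z]) <= B / r ^+ M * pcabs z ^+ M.
Proof.
move=> r0 B0 zr av aB gap.
apply: (converges_le (N := n) (truncation_converges zr av)) => N nN.
have E0 : 0 <= B / r ^+ M * pcabs z ^+ M.
  by rewrite mulr_ge0 ?divr_ge0 ?exprn_ge0 ?pcabs_ge0 ?(ltW r0).
rewrite !horner_truncation (big_cat_nat (leq0n n) nN) /=.
rewrite [X in X - _]addrC addrK.
rewrite big_nat_cond; apply: pcabs_sum_le => // j /andP [/andP [nj _] _].
have [jM|Mj] := ltnP j M; first by rewrite gap ?nj // mul0r pcabs0.
have -> : B / r ^+ M * pcabs z ^+ M = B * (pcabs z / r) ^+ M.
  by rewrite expr_div_n -mulrA [_ / _]mulrC.
have zr1 : 0 <= pcabs z / r <= 1.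
  by rewrite divr_ge0 ?pcabs_ge0 ?(ltW r0) // ler_pdivrMr ?mul1r.
apply: (@le_trans _ _ (B * (pcabs z / r) ^+ j)); last first.
  by rewrite ler_wpM2l // ler_wiXn2l //; case/andP: zr1.
rewrite expr_div_n mulrA ler_pdivlMr ?exprn_gt0 // pcabsM pcabsX mulrAC.
by rewrite ler_wpM2r ?exprn_ge0 ?pcabs_ge0.
Qed.

Hypothesis p_prime : prime p.

(** Let [P(z, f(z)) = 0]. At a gap [n <= j < M] of [f], with [f_n] the
    truncation at [n], [P(z, f_n(z))] is as small as [f - f_n], so it vanishes
    at 0 to order [M]. When [M = c * (n + 1)] bounds its size, it is the zero
    polynomial. Then [f_n] is a root of [P(z, Y)], and for large [n] its degree
    exceeds those of the finitely many roots of a nonzero [P]. *)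
Lemma lacunary_transcendental (Omega : set K) a r : 0 < r ->
    (forall z, pcabs z <= r -> Omega z) ->
    vanishing (fun n => pcabs (a n) * r ^+ n) ->
    (forall N, exists2 j, (N <= j)%N & a j != 0) ->
    (forall c N, exists2 n, (N <= n)%N &
       forall j, (n <= j < c * n.+1)%N -> a j = 0) ->
  transcendental_on Omega (ps_eval a).
Proof.
move=> r0 rO av a_inf gaps P PO.
pose Q := swapXY P.
suff : Q = 0 by move=> Q0; rewrite -[P]swapXYK -/Q Q0 raddf0.
apply: contrapT => /eqP Q0.
have [s sP] := finitely_many_roots Q0.
have [B' B'0 aB'] := vanishing_bounded av.
pose B := Num.max r B'.
have B0 : 0 <= B by rewrite le_max ltW.
have aB j : pcabs (a j) * r ^+ j <= B by rewrite le_max aB' orbT.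
have [C C0 CP] := horner2_lipschitz Q B0.
have [c cP] := size_horner2_le Q.
have [j jN aj] := a_inf (\max_(h <- s) size h).
have [n nN gap] := gaps c j.+1.
set M := (c * n.+1)%N in gap.
have fB z : pcabs z <= r -> pcabs (ps_eval a z) <= B.
  move=> zr; rewrite -[ps_eval a z]subr0.
  apply: (converges_le (N := 0%N) (truncation_converges zr av)) => N _.
  by rewrite subr0; apply: truncation_bounded aB.
have h0 : Q.[truncation a n] = 0.
  apply: (@small_poly_eq0 _ _ _ p_prime _ M (C * (B / r ^+ M)) r) => //.
  - by rewrite mulr_ge0 ?divr_ge0 ?exprn_ge0 ?(ltW r0).
  - by rewrite (leq_trans (cP _)) // leq_mul // ltnS size_poly.
  move=> z z0 zr; rewrite horner_hornerC.
  have Qz : Q.[ps_eval a z, z] = 0 by rewrite horner2_swapXY PO //; exact: rO.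
  rewrite -[Q.[_, _]]subr0 -Qz pcabs_distC -mulrA.
  rewrite (le_trans (CP _ _ _ _ _ _)) //.
  - exact: fB.
  - exact: truncation_bounded aB.
  - by rewrite le_max zr.
  by rewrite ler_wpM2l // truncation_tail.
have := sP (truncation a n); rewrite /root h0 eqxx => /(_ isT) ts.
have : (size (truncation a n) <= \max_(h <- s) size h)%N.
  exact: (@leq_bigmax_seq _ s xpredT (fun h : {poly K} => size h)).
move=> /leq_trans /(_ jN) /leq_sizeP /(_ j (leqnn j)).
by rewrite coef_poly nN => /eqP; rewrite (negbTE aj).
Qed.

End PowerSeries.

(** * Building blocks of the series *)

Section Blocks.
Variables (R : realType) (p : nat) (K : padicComplexType R p).
Hypothesis p_prime : prime p.
Implicit Types (x y z : K) (e r : R).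

(** The absolute values of consecutive powers of [p] differ by a factor [p]. *)
Lemma rational_scale (y : R) : 0 < y ->
  exists t : rat, p%:R^-1 <= pcabs (ratK t : K) * y <= 1.
Proof.
move=> y0; have p0 : 0 < p%:R :> R by rewrite ltr0n prime_gt0.
have pi0 : 0 <= p%:R^-1 :> R by rewrite invr_ge0 ltW.
have abs_pX n : pcabs (ratK (p%:R ^+ n) : K) = p%:R ^- n.
  by rewrite rmorphXn rmorph_nat pcabsX pcabs_prime // exprVn.
have [y1|y1] := ltP 1 y.
  have exN : exists n, p%:R ^- n * y <= 1.
    have [N NP] := vanishing_expr pi0 (invp_lt1 R p_prime) (divr_gt0 ltr01 y0).
    by exists N; rewrite -ler_pdivlMr // -exprVn ltW // NP.
  case: (ex_minnP exN) => [[|n] nP nmin].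
    by move: nP; rewrite expr0 invr1 mul1r leNgt y1.
  exists (p%:R ^+ n.+1); rewrite abs_pX nP andbT exprS invfM -mulrA.
  rewrite ler_peMr // leNgt; apply/negP => /ltW /nmin; by rewrite ltnn.
have exN : exists n, 1 < p%:R ^+ n.+1 * y.
  have [N NP] := vanishing_expr pi0 (invp_lt1 R p_prime) y0.
  exists N; have := NP N.+1 (leqnSn N).
  by rewrite exprVn -ltr_pdivrMl ?exprn_gt0 // mulr1.
case: (ex_minnP exN) => n nP nmin.
exists (p%:R ^- n); rewrite fmorphV pcabsV abs_pX invrK; apply/andP; split.
  by rewrite -[leLHS]mulr1 ler_pdivrMl // mulrA -exprS ltW.
case: n nP nmin => [|n] _ nmin; first by rewrite mul1r.
by rewrite leNgt; apply/negP => /nmin; rewrite ltnn.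
Qed.

(** The candidates are [1], [1 + p] and [1 + 2p]. A factor of absolute value 1
    can thus serve to satisfy two inequations without changing any size. *)
Lemma unit_avoiding (v1 v2 : K) :
  exists u : nat, [/\ pcabs (u%:R : K) = 1, u%:R != v1 & u%:R != v2].
Proof.
have up i : pcabs ((1 + i * p)%:R : K) = 1.
  apply: pcabs_nat_eq1.
  by rewrite dvdn_addl ?dvdn_mull // dvdn1 gtn_eqF ?prime_gt1.
have inj i j : (1 + i * p)%:R = (1 + j * p)%:R :> K -> i = j.
  move=> /natrK_inj /eqP; rewrite eqn_add2l eqn_pmul2r ?prime_gt0 //.
  by move=> /eqP.
apply: contrapT => no.
have all12 i : (1 + i * p)%:R = v1 \/ (1 + i * p)%:R = v2.
  apply: contrapT => /not_orP [/eqP i1 /eqP i2]; apply: no.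
  by exists (1 + i * p)%N.
have neq i j (v : K) : (1 + i * p)%:R = v -> (1 + j * p)%:R = v -> i = j.
  by move=> hi hj; exact: inj _ _ (etrans hi (esym hj)).
case: (all12 0%N) (all12 1%N) (all12 2%N) => h0 [] h1 [] h2;
  by [have := neq _ _ _ h0 h1 | have := neq _ _ _ h0 h2 |
      have := neq _ _ _ h1 h2].
Qed.

Lemma eventually_forall (n : nat) (P : nat -> nat -> Prop) :
    (forall i, (i < n)%N -> exists N, forall k, (N <= k)%N -> P i k) ->
  exists N, forall k, (N <= k)%N -> forall i, (i < n)%N -> P i k.
Proof.
elim: n => [|n IH] iP; first by exists 0%N.
have [|N NP] := IH; first by move=> i /ltnW; exact: iP.
have [N' N'P] := iP n (ltnSn n).
exists (maxn N N') => k; rewrite geq_max => /andP [Nk N'k] i.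
by rewrite ltnS leq_eqVlt => /predU1P [->|]; [exact: N'P | exact: NP].
Qed.

(** The requirements on the next block [T] of the series. [block_le] and
    [block_ge] will fix the radius of convergence, [block_low] makes the gaps,
    [block_root] makes the values on the exceptional set finite sums,
    [block_small] protects the inequalities obtained before, [block_avoid] adds
    a new one, and [block_diag] separates the series from [g]. *)
Record is_block (s : seq K) (r : R) (M n : nat) (V : nat -> Prop)
    (alpha : nat -> K) (delta : nat -> R) (x w : K) (g : nat -> K)
    (T : {poly rat}) : Prop := IsBlock {
  block_low : forall j, (j < M)%N -> T`_j = 0;
  block_le : forall j, pcabs (ratK T`_j : K) * r ^+ j <= 1;
  block_ge : p%:R^-1 <= pcabs (ratK (lead_coef T) : K) * r ^+ (size T).-1;
  block_root : forall y, y \in s -> (map_poly ratK T).[y] = 0;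
  block_small : forall i, (i < n)%N -> V i ->
    pcabs (map_poly ratK T).[alpha i] < delta i;
  block_avoid : x != 0 -> x \notin s -> (map_poly ratK T).[x] != w;
  block_diag : ratK (lead_coef T) != g (size T).-1;
  block_int : 1 <= r -> forall j, exists m : int, T`_j = m%:~R }.

(** The block is [u * d * t * 'X^k * q]. A large [k] makes it small at the
    points [alpha i] inside the circle, [t] adjusts its size on the circle, [d]
    clears denominators, and [u] satisfies the two inequations. As [u] and [d]
    are [p]-adic units, only [t] and [k] matter for absolute values. *)
Lemma block_exists (q : {poly rat}) (s : seq K) (r : R) (M n : nat)
    (V : nat -> Prop) (alpha : nat -> K) (delta : nat -> R) (x w : K)
    (g : nat -> K) :
    map_poly ratK q = \prod_(y <- s) ('X - y%:P) -> 0 < r ->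
    (forall y, y \in s -> pcabs y <= r) ->
    (forall i, (i < n)%N -> V i -> pcabs (alpha i) < r /\ 0 < delta i) ->
  exists T, is_block s r M n V alpha delta x w g T.
Proof.
move=> qE r0 sr ad.
have [k [Mk kP]] : exists k, (M <= k)%N /\
    forall i, (i < n)%N -> V i -> (pcabs (alpha i) / r) ^+ k < delta i.
  have [|N NP] := @eventually_forall n
    (fun i k => V i -> (pcabs (alpha i) / r) ^+ k < delta i).
    move=> i ni; have [Vi|Vi] := EM (V i); last by exists 0%N.
    have [ar d0] := ad i ni Vi.
    have [|||N NP] := @vanishing_expr R (pcabs (alpha i) / r) _ _ (delta i).
    - by rewrite divr_ge0 ?pcabs_ge0 ?ltW.
    - by rewrite ltr_pdivrMr ?mul1r.
    - by [].
    by exists N => k /NP.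
  exists (maxn M N); split; first exact: leq_maxl.
  by move=> i ni; apply: NP => //; exact: leq_maxr.
pose D := size s.
have rkD : 0 < r ^+ (k + D) by rewrite exprn_gt0.
have [t /andP [t_ge t_le]] := rational_scale rkD.
have coefq j : pcabs (ratK q`_j : K) * r ^+ j <= r ^+ D.
  by rewrite -coef_map qE; exact: pcabs_coef_prod_XsubC (ltW r0) sr.
pose T1 := 'X^k * q; pose T0 := t *: T1.
have T0_le j : pcabs (ratK T0`_j : K) * r ^+ j <= 1.
  rewrite coefZ coefXnM; case: ltnP => [|kj].
    by rewrite mulr0 rmorph0 pcabs0 mul0r ler01.
  rewrite (le_trans _ t_le) // rmorphM pcabsM -mulrA ler_wpM2l ?pcabs_ge0 //.
  have -> : r ^+ j = r ^+ k * r ^+ (j - k) by rewrite -exprD subnKC.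
  by rewrite exprD mulrCA ler_wpM2l ?coefq ?exprn_ge0 ?(ltW r0).
(* For [r < 1] the coefficients need not be [p]-integral, and [d = 1]. *)
have [d [d1 dT]] : exists d : int, pcabs (d%:~R : K) = 1 /\
    (1 <= r -> forall j, exists m : int, d%:~R * T0`_j = m%:~R).
  have [r1|r1] := boolP (1 <= r); last by exists 1; rewrite pcabs1.
  have [|d [d1 dT]] := @clear_denominators _ _ K p_prime T0; last by exists d.
  move=> j; rewrite (le_trans _ (T0_le j)) // ler_peMr ?pcabs_ge0 //.
  exact: exprn_ege1.
have t0 : t != 0.
  apply: contraTneq t_ge => ->; rewrite rmorph0 pcabs0 mul0r -ltNge.
  by rewrite invr_gt0 ltr0n prime_gt0.
have tK0 : ratK t != 0 :> K by rewrite fmorph_eq0.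
have dK0 : d%:~R != 0 :> K by rewrite -pcabs_gt0 d1 ltr01.
have dt0 : d%:~R * ratK t != 0 :> K by exact: mulf_neq0.
pose W := d%:~R * ratK t * (map_poly ratK T1).[x].
have [u [u1 uW uL]] := unit_avoiding (w / W) (g (k + D)%N / (d%:~R * ratK t)).
have u0 : u%:R != 0 :> K by rewrite -pcabs_gt0 u1 ltr01.
pose c : rat := u%:R * d%:~R * t.
have cK : ratK c = u%:R * (d%:~R * ratK t) :> K.
  by rewrite !rmorphM /= rmorph_nat rmorph_int mulrA.
have abs_c : pcabs (ratK c : K) = pcabs (ratK t : K).
  by rewrite cK !pcabsM u1 d1 !mul1r.
have c0 : c != 0.
  by rewrite -(fmorph_eq0 (@ratK R p K)) -pcabs_gt0 abs_c pcabs_gt0.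
have qm : q \is monic.
  by rewrite -(map_monic (@ratK R p K)) qE monic_prod_XsubC.
have sq : size q = D.+1.
  by rewrite -(size_map_poly (@ratK R p K)) qE size_prod_XsubC.
have T1m : T1 \is monic by rewrite monicMl ?monicXn.
have sT : (size (c *: T1)).-1 = (k + D)%N.
  by rewrite size_scale // size_monicM ?monicXn ?monic_neq0 // size_polyXn sq
    addSn addnS.
have lT : lead_coef (c *: T1) = c by rewrite lead_coefZ (monicP T1m) mulr1.
have TE : c *: T1 = (u%:R * d%:~R) *: T0 by rewrite scalerA.
have mT : map_poly ratK (c *: T1) = ratK c *: map_poly ratK T1 :> {poly K}.
  by rewrite map_polyZ.
have mT1 z : (map_poly ratK T1).[z] = z ^+ k * (map_poly ratK q).[z] :> K.
  by rewrite rmorphM /= map_polyXn hornerM hornerXn.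
exists (c *: T1); split; rewrite ?sT ?lT ?mT.
- move=> j jM; rewrite coefZ coefXnM (leq_trans jM Mk) mulr0 //.
- move=> j; rewrite TE coefZ rmorphM pcabsM rmorphM pcabsM /= rmorph_nat.
  by rewrite rmorph_int u1 d1 !mul1r.
- by rewrite abs_c.
- by move=> y ys; rewrite hornerZ mT1 qE; move: ys; rewrite -root_prod_XsubC
    => /rootP ->; rewrite !mulr0.
- move=> i ni Vi; have [ar _] := ad i ni Vi.
  apply: le_lt_trans (kP i ni Vi).
  rewrite hornerZ pcabsM abs_c mT1 [X in _ * X]pcabsM pcabsX expr_div_n.
  rewrite ler_pdivlMr ?exprn_gt0 // mulrCA -mulrA.
  rewrite ler_piMr ?exprn_ge0 ?pcabs_ge0 //.
  rewrite (le_trans _ t_le) // exprD -mulrA ler_wpM2l ?pcabs_ge0 //.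
  rewrite mulrC ler_wpM2l ?exprn_ge0 ?(ltW r0) // qE.
  by apply: pcabs_horner_prod_XsubC => //; exact: ltW.
- move=> x0 xs; have W0 : W != 0.
    rewrite /W mT1 (mulf_neq0 dt0) // mulf_neq0 ?expf_neq0 // qE.
    by rewrite -[_ == 0]/(root _ x) root_prod_XsubC.
  apply: contraNneq uW => <-; rewrite hornerZ cK.
  by rewrite -[X in X / W]mulrA -/W mulfK.
- by apply: contraNneq uL => <-; rewrite cK mulfK.
- move=> r1 j; have [m mE] := dT r1 j; exists (u%:Z * m).
  by rewrite TE coefZ -mulrA mE intrM.
Qed.

End Blocks.

(** * Series assembled from blocks *)

Section Assembly.
Variables (R : realType) (p : nat) (K : padicComplexType R p).
Hypothesis p_prime : prime p.
Variables (F T : nat -> {poly rat}) (radius : nat -> R).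
Local Notation M n := (n.+1 * (size (F n)).+1)%N.
Hypothesis F0 : F 0 = 0.
Hypothesis FS : forall n, F n.+1 = F n + T n.
Hypothesis radius_gt0 : forall n, 0 < radius n.
Hypothesis T_low : forall n j, (j < M n)%N -> (T n)`_j = 0.
Hypothesis T_le : forall n j, pcabs (ratK (T n)`_j : K) * radius n ^+ j <= 1.
Hypothesis T_ge : forall n,
  p%:R^-1 <= pcabs (ratK (lead_coef (T n)) : K) * radius n ^+ (size (T n)).-1.

(** The coefficients of the limit of the [F n]; the one of degree [j] does not
    change after step [j]. *)
Definition limit_coef (j : nat) : K := ratK (F j)`_j.
Local Notation a := limit_coef.

Lemma block_lead_neq0 n : lead_coef (T n) != 0.
Proof.
apply: contraTneq (T_ge n) => ->; rewrite rmorph0 pcabs0 mul0r -ltNge.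
by rewrite invr_gt0 ltr0n prime_gt0.
Qed.

Lemma gap_le_degree n : (M n <= (size (T n)).-1)%N.
Proof.
rewrite leqNgt; apply/negP => /T_low h.
by have := block_lead_neq0 n; rewrite lead_coefE h eqxx.
Qed.

Lemma size_lt_gap n : (size (F n) < M n)%N.
Proof. by rewrite -[X in (X <= _)%N]mul1n leq_mul. Qed.

Lemma size_partialS n : size (F n.+1) = size (T n).
Proof.
rewrite FS addrC size_polyDl //.
apply: leq_trans (size_lt_gap n) _.
by rewrite (leq_trans (gap_le_degree n)) // leq_pred.
Qed.

Lemma size_partial_lt n : (size (F n) < size (F n.+1))%N.
Proof.
rewrite size_partialS (leq_trans (size_lt_gap n)) //.
by rewrite (leq_trans (gap_le_degree n)) // leq_pred.
Qed.

Lemma size_partial_mono n m : (n <= m)%N -> (size (F n) <= size (F m))%N.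
Proof.
move=> /subnK <-; elim: (m - n)%N => // k IH; rewrite addSn.
by rewrite (leq_trans IH) // ltnW // size_partial_lt.
Qed.

Lemma leq_size_partial n : (n <= size (F n))%N.
Proof. by elim: n => // n IH; exact: leq_ltn_trans IH (size_partial_lt n). Qed.

Lemma coef_partial n m j : (j < M n)%N -> (n <= m)%N -> (F m)`_j = (F n)`_j.
Proof.
move=> jM /subnK <-; elim: (m - n)%N => // k IH; rewrite addSn FS coefD IH.
rewrite T_low ?addr0 // (leq_trans jM) // leq_mul // ?ltnS ?leq_addl //.
by rewrite size_partial_mono // leq_addl.
Qed.

Lemma limit_coef_partial n j : (j < M n)%N -> a j = ratK (F n)`_j.
Proof.
move=> jM; congr ratK; have [nj|/ltnW jn] := leqP n j.
  exact: coef_partial.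
apply/esym/coef_partial => //.
by rewrite (leq_ltn_trans (leq_size_partial j)) // size_lt_gap.
Qed.

Lemma limit_coef_block n j : (size (F n) <= j < size (T n))%N ->
  a j = ratK (T n)`_j.
Proof.
move=> /andP [Fj jT].
rewrite (@limit_coef_partial n.+1); last first.
  by rewrite (leq_trans jT) // -size_partialS ltnW // size_lt_gap.
by rewrite FS coefD (nth_default 0 Fj) add0r.
Qed.

Lemma limit_coef_lead n : a (size (T n)).-1 = ratK (lead_coef (T n)).
Proof.
rewrite (@limit_coef_block n) ?lead_coefE //; apply/andP; split.
  exact: leq_trans (ltnW (size_lt_gap n)) (gap_le_degree n).
by rewrite prednK // size_poly_gt0 -lead_coef_eq0 block_lead_neq0.
Qed.

Lemma limit_coef_late n j : (size (F n) <= j)%N ->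
  exists2 m, (n <= m)%N & a j = ratK (T m)`_j.
Proof.
move=> nj.
have exm : exists m, (j < size (T m))%N.
  by exists j; rewrite -size_partialS; exact: leq_size_partial.
case: (ex_minnP exm) => m jm mmin; exists m.
  rewrite leqNgt; apply/negP => mn.
  have := leq_trans (size_partial_mono mn) nj.
  by rewrite size_partialS leqNgt jm.
apply: limit_coef_block; rewrite jm andbT.
case: m {jm} mmin => [|m] mmin; first by rewrite F0 size_poly0.
by rewrite size_partialS leqNgt; apply/negP => /mmin; rewrite ltnn.
Qed.

Lemma truncation_limit n : truncation a (size (F n)) = map_poly ratK (F n).
Proof.
apply/polyP => j; rewrite coef_poly coef_map /=; case: ltnP => [jF|Fj].
  by rewrite (limit_coef_partial (ltn_trans jF (size_lt_gap n))).
by rewrite nth_default // rmorph0.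
Qed.

Lemma partial_converges z r : pcabs z <= r ->
    vanishing (fun j => pcabs (a j) * r ^+ j) ->
  converges_to (fun n => (map_poly ratK (F n)).[z]) (ps_eval a z).
Proof.
move=> zr /(truncation_converges zr) av e e0; have [N NP] := av e e0.
exists N => n Nn; rewrite -truncation_limit; apply: NP.
exact: leq_trans Nn (leq_size_partial n).
Qed.

Lemma limit_gaps c N : exists2 n, (N <= n)%N &
  forall j, (n <= j < c * n.+1)%N -> a j = 0.
Proof.
exists (size (F (maxn c N))).
  exact: leq_trans (leq_maxr c N) (leq_size_partial _).
move=> j /andP [Fj jc]; rewrite (@limit_coef_partial (maxn c N)).
  by rewrite nth_default // rmorph0.
rewrite (leq_trans jc) // leq_mul // (leq_trans (leq_maxl c N)) //.
Qed.

Lemma leq_degree n : (n <= (size (T n)).-1)%N.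
Proof.
apply: leq_trans (gap_le_degree n).
exact: leq_trans (leq_size_partial n) (ltnW (size_lt_gap n)).
Qed.

Lemma limit_coef_infinite N : exists2 j, (N <= j)%N & a j != 0.
Proof.
exists (size (T N)).-1; first exact: leq_degree.
by rewrite limit_coef_lead fmorph_eq0 block_lead_neq0.
Qed.

Section Radius.
Variable rho : \bar R.
Hypothesis radius_le : forall n, ((radius n)%:E <= rho)%E.
Hypothesis radius_cvg : forall r, (r%:E < rho)%E ->
  exists2 r', r < r' & exists N, forall n, (N <= n)%N -> r' <= radius n.

Lemma limit_vanishing r : 0 <= r -> (r%:E < rho)%E ->
  vanishing (fun j => pcabs (a j) * r ^+ j).
Proof.
move=> r0 /radius_cvg [r' rr' [N NP]].
have r'0 : 0 < r' := le_lt_trans r0 rr'.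
have q01 : 0 <= r / r' < 1.
  by rewrite divr_ge0 ?(ltW r'0) //= ltr_pdivrMr // mul1r.
case/andP: q01 => q0 q1.
apply: (vanishing_le (N := size (F N))) (vanishing_expr q0 q1) => j Nj.
have [m Nm ->] := limit_coef_late Nj.
rewrite expr_div_n ler_pdivlMr ?exprn_gt0 // mulrAC ler_piMl ?exprn_ge0 //.
apply: le_trans (T_le m j); rewrite ler_wpM2l ?pcabs_ge0 //.
by rewrite lerXn2r ?nnegrE ?(ltW r'0) ?(ltW (radius_gt0 m)) ?NP.
Qed.

(** Every block contributes a leading term of size at least [1/p] on a circle of
    radius at most [rho], so there is no convergence to 0 beyond [rho]. *)
Lemma limit_radius : radius_of_convergence a = rho.
Proof.
have rho_gt0 : (0 < rho)%E.
  by apply: lt_le_trans (radius_le 0%N); rewrite lte_fin.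
apply/eqP; rewrite eq_le; apply/andP; split.
  apply: ge_ereal_sup => _ [r [r0 av]] <-; rewrite leNgt; apply/negP => rho_r.
  have ar0 n : 0 <= pcabs (a n) * r ^+ n.
    by rewrite mulr_ge0 ?pcabs_ge0 ?exprn_ge0.
  have pV0 : 0 < p%:R^-1 :> R by rewrite invr_gt0 ltr0n prime_gt0.
  have [N NP] := (cvg0_vanishing ar0).1 av _ pV0.
  have := NP _ (leq_degree N); rewrite limit_coef_lead ltNge => /negP; apply.
  rewrite (le_trans (T_ge N)) // ler_wpM2l ?pcabs_ge0 //.
  rewrite lerXn2r ?nnegrE ?(ltW (radius_gt0 N)) // -lee_fin.
  exact: le_trans (radius_le N) (ltW rho_r).
rewrite leNgt; apply/negP => sup_lt.
have in_sup r : 0 <= r -> (r%:E < rho)%E -> (r%:E <= radius_of_convergence a)%E.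
  move=> r0 rrho; apply: ereal_sup_ubound; exists r => //; split => //.
  apply/cvg0_vanishing; last exact: limit_vanishing.
  by move=> n; rewrite mulr_ge0 ?pcabs_ge0 ?exprn_ge0.
have [r r0 /andP [sr rrho]] : exists2 r, 0 <= r &
    (radius_of_convergence a < r%:E)%E && (r%:E < rho)%E.
  move: sup_lt (in_sup 0 (lexx 0) rho_gt0).
  case: radius_of_convergence => [s||//]; last by rewrite ltNge leey.
  case: (rho) => [t| |//]; rewrite ?lte_fin lee_fin => st s0.
    exists ((s + t) / 2).
      by rewrite divr_ge0 // addr_ge0 // ltW // (le_lt_trans s0).
    by rewrite !lte_fin !midf_lt.
  by exists (s + 1); rewrite ?addr_ge0 // lte_fin ltrDl ltr01 ltry.
by have := in_sup r r0 rrho; rewrite leNgt sr.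
Qed.

Lemma limit_transcendental : transcendental_on (open_disk rho) (ps_eval a).
Proof.
have r0 := radius_gt0 0; set r := radius 0 / 2.
have rrho : (r%:E < rho)%E.
  apply: lt_le_trans (radius_le 0%N).
  by rewrite lte_fin ltr_pdivrMr // ltr_pMr // ltr1n.
have {}r0 : 0 < r by rewrite divr_gt0.
apply: (lacunary_transcendental p_prime r0).
- by move=> z zr; apply: le_lt_trans rrho; rewrite lee_fin.
- exact: limit_vanishing (ltW r0) rrho.
- exact: limit_coef_infinite.
- exact: limit_gaps.
Qed.

End Radius.
End Assembly.

(** * Enumerations *)

Lemma enumerate (T : Type) (A : set T) (x0 : T) : A x0 -> countable A ->
  exists e : nat -> T,
    (forall n, A (e n)) /\ (forall x, A x -> exists n, e n = x).
Proof.
move=> Ax0 /countable_injP [f f_inj].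
have /choice [e eP] : forall n, exists x, A x /\
    (forall y, A y -> f y = n -> x = y).
  move=> n; have [[y [Ay fy]]|no] := EM (exists y, A y /\ f y = n).
    exists y; split=> // z Az fz; apply: f_inj; rewrite ?inE ?fy //.
  by exists x0; split=> // y Ay fy; case: no; exists y.
exists e; split=> [n|x Ax]; first by have [] := eP n.
by exists (f x); have [_] := eP (f x); exact.
Qed.

(** Cantor's argument, in the form that suits a construction able to avoid any
    given sequence. *)
Lemma uncountable_diagonal (T : pointedType) (A : set (nat -> T)) :
    (forall g : nat -> nat -> T, exists2 a, A a & forall n, a <> g n) ->
  ~ countable A.
Proof.
move=> diag cA.
have [a0 Aa0 _] := diag (fun _ _ => point).
have [g [_ gA]] := enumerate Aa0 cA.
by have [a /gA [n gn] /(_ n)] := diag g; rewrite gn.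
Qed.

(** * The construction *)

Section Construction.
Variables (R : realType) (p : nat) (K : padicComplexType R p).
Hypothesis p_prime : prime p.

Lemma countable_Qbar : countable (@Qbar K).
Proof.
have /choice [s sP] : forall q : {poly rat}, exists s : seq K,
    q != 0 -> forall x, root (map_poly ratK q) x -> x \in s.
  move=> q; have [->|q0] := eqVneq q 0; first by exists nil.
  have [|s sP] := @finitely_many_roots K (map_poly ratK q).
    by rewrite map_poly_eq0.
  by exists s.
have sub : @Qbar K `<=` \bigcup_(q in [set: {poly rat}]) [set` s q].
  by move=> x [q q0 qx]; exists q => //=; exact: sP.
apply: sub_countable (subset_card_le sub) _.
apply: bigcup_countable => [|q _]; first exact: countableP.
by apply: finite_set_countable; exact: finite_seq.
Qed.

Variable rho : \bar R.
Hypothesis rho_gt0 : (0 < rho)%E.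

(** For finite [rho] the constant [rho] will do, as the points lie in the open
    disk; otherwise [r n] is [n + 1] plus the absolute values of the points of
    stage [n]. *)
Lemma radii_exist (X : nat -> seq K) :
    (forall n x, x \in X n -> open_disk rho x) ->
  exists r : nat -> R, [/\ forall n, 0 < r n /\ ((r n)%:E <= rho)%E,
    forall n x, x \in X n -> pcabs x < r n,
    (1 <= rho)%E -> forall n, 1 <= r n &
    forall r0, (r0%:E < rho)%E ->
      exists2 r1, r0 < r1 & exists N, forall n, (N <= n)%N -> r1 <= r n].
Proof.
case: rho rho_gt0 => [r|_|//]; first rewrite lte_fin => r0; move=> Xr.
  exists (fun=> r); split=> //.
  by move=> r0'; rewrite lte_fin => r0'r; exists r => //; exists 0%N.
have sum_ge0 n : 0 <= \sum_(x <- X n) pcabs x.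
  by apply: sumr_ge0 => x _; exact: pcabs_ge0.
exists (fun n => n.+1%:R + \sum_(x <- X n) pcabs x); split.
- by move=> n; rewrite leey ltr_wpDr ?ltr0n.
- move=> n x xX; rewrite (big_rem x) //= addrCA ltrDl ltr_wpDr ?ltr0n //.
  by apply: sumr_ge0 => y _; exact: pcabs_ge0.
- by move=> _ n; rewrite -[leLHS]addr0 lerD // ler1n.
move=> r0 _; exists (r0 + 1); first by rewrite ltrDl.
exists (Num.bound r0) => n Nn; rewrite -[leLHS]addr0 lerD // -natr1 lerD //.
by rewrite (le_trans (ltW (unstable.ltr_bound r0))) // ler_nat.
Qed.

Variable S : set K.
Hypothesis S_sub : S `<=` Qbar `&` open_disk rho.
Hypothesis S_conj : closed_under_conjugation S.
Hypothesis S0 : S 0.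

(** The state of the recursion is the partial sum [F n]. Its invariant, that the
    inequalities of the earlier steps hold, is what makes the next distances
    [|F (alpha i) - beta i|] positive, hence the next block exist. *)
Lemma diagonal_series (g : nat -> nat -> K) : exists a : nat -> K,
  [/\ (forall n, Qset (a n)) /\ ((1 <= rho)%E -> forall n, Zset (a n)),
      radius_of_convergence a = rho,
      transcendental_on (open_disk rho) (ps_eval a),
      exceptional_set (open_disk rho) (ps_eval a) = S &
      forall n, a <> g n].
Proof.
have SA : S `<=` Qbar by move=> x /S_sub [].
have Qbar0 : @Qbar K 0 by exact: SA.
have [s [sS sE]] : exists s : nat -> K, (forall n, S (s n)) /\
    (forall x, S x -> exists n, s n = x).
  by apply: enumerate S0 (sub_countable (subset_card_le SA) countable_Qbar).
have [pr [_ prE]] : exists e : nat -> K * K,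
    (forall n, (Qbar `*` Qbar) (e n)) /\
    (forall x, (Qbar `*` Qbar) x -> exists n, e n = x).
  apply: (@enumerate _ _ (0, 0)); first by split.
  by apply: countableX; exact: countable_Qbar.
pose alpha n := (pr n).1; pose beta n := (pr n).2.
(* Where [V n] fails, step [n] has no inequality to achieve. *)
pose V n := ~ S (alpha n) /\ open_disk rho (alpha n).
have /choice [m /choice [l mlP]] : forall i, exists m : {poly rat},
    exists l : seq K, [/\ map_poly ratK m = \prod_(y <- l) ('X - y%:P),
      s i \in l & forall y, y \in l -> S y].
  by move=> i; exact: conjugates_polynomial SA S_conj (sS i).
pose q n := \prod_(i <- iota 0 n.+1) m i.
pose L n := flatten [seq l i | i <- iota 0 n.+1].
have qE n : map_poly ratK (q n) = \prod_(y <- L n) ('X - y%:P).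
  rewrite rmorph_prod big_flatten big_map; apply: eq_bigr => i _.
  by have [] := mlP i.
have LS n y : y \in L n -> S y.
  by move=> /flattenP [_ /mapP [i _ ->]]; have [_ _] := mlP i; exact.
have sL i n : (i <= n)%N -> s i \in L n.
  move=> i_n; apply/flattenP; exists (l i); last by have [] := mlP i.
  by apply: map_f; rewrite mem_iota ltnS.
pose X n := L n ++ [seq alpha i | i <- iota 0 n & `[< V i >]].
have [|r [r_gt0 Xr r_ge1 r_cvg]] := @radii_exist X.
  move=> n x; rewrite mem_cat => /orP [/LS /S_sub [//]|].
  by move=> /mapP [i]; rewrite mem_filter => /andP [/asboolP [_ iV] _] ->.
pose val (F : {poly rat}) x : K := (map_poly ratK F).[x].
(* A new term smaller than [|val F (alpha i) - beta i|] leaves that distance as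
   it is; the new inequality at [alpha n] excludes one value of the new term. *)
pose block n (F : {poly rat}) := is_block (L n) (r n) (n.+1 * (size F).+1) n V
  alpha (fun i => pcabs (val F (alpha i) - beta i)) (alpha n)
  (beta n - val F (alpha n)) (g n).
pose Inv n (F : {poly rat}) :=
  forall i, (i < n)%N -> V i -> val F (alpha i) != beta i.
have /choice [T TP] : forall nF : nat * {poly rat}, exists T : {poly rat},
    Inv nF.1 nF.2 -> block nF.1 nF.2 T.
  move=> [n F] /=; have [FI|] := EM (Inv n F); last by exists 0.
  have [||||T] := @block_exists _ _ K p_prime (q n) (L n) (r n)
    (n.+1 * (size F).+1) n V alpha (fun i => pcabs (val F (alpha i) - beta i))
    (alpha n) (beta n - val F (alpha n)) (g n).
  - exact: qE.
  - by have [] := r_gt0 n.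
  - by move=> y yL; rewrite ltW // Xr // mem_cat yL.
  - move=> i ni Vi; split; last by rewrite pcabs_gt0 subr_eq0 FI.
    rewrite Xr // mem_cat; apply/orP; right; apply: map_f.
    by rewrite mem_filter mem_iota add0n ni !andbT; apply/asboolP.
  by exists T.
pose F := fix F n := if n is n'.+1 then F n' + T (n', F n') else 0.
pose t n := T (n, F n).
have FS n : F n.+1 = F n + t n by [].
have valS n x : val (F n.+1) x = val (F n) x + val (t n) x.
  by rewrite /val FS rmorphD hornerD.
have FI n : Inv n (F n).
  elim: n => [|n IH] i //.
  have [/= _ _ _ _ small avoid _ _] := TP (n, F n) IH.
  rewrite ltnS leq_eqVlt => /predU1P [->|ni] Vi; rewrite valS.
    have [nS _] := Vi.
    have a0 : alpha n != 0 by apply/eqP => a0; apply: nS; rewrite a0.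
    have aL : alpha n \notin L n by apply/negP => /LS.
    by apply: contraNneq (avoid a0 aL) => <-; rewrite addrAC subrr add0r.
  rewrite -subr_eq0 addrAC -pcabs_neq0 pcabsD_id ?small //.
  by rewrite pcabs_neq0 subr_eq0 IH.
have tP n : block n (F n) (t n) := TP (n, F n) (FI n).
pose a := limit_coef K F.
have r_pos n : 0 < r n := (r_gt0 n).1.
have r_le n : ((r n)%:E <= rho)%E := (r_gt0 n).2.
have t_low n := block_low (tP n).
have t_le n := block_le (tP n).
have t_ge n := block_ge (tP n).
have FF0 : F 0%N = 0 by [].
have F_cvg z : open_disk rho z ->
    converges_to (fun n => val (F n) z) (ps_eval a z).
  move=> zrho; apply: (partial_converges p_prime FS t_low t_ge (lexx _)).
  apply: (limit_vanishing p_prime FF0 FS r_pos t_low t_le t_ge r_cvg) => //.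
  exact: pcabs_ge0.
exists a; split.
- split=> [n|rho1 n]; first by exists (F n)`_n.
  have r1 := r_ge1 rho1.
  have [c cE] : exists c : int, (F n)`_n = c%:~R.
    elim: {1}n => [|k [c cE]]; first by exists 0; rewrite coef0.
    have [d dE] := block_int (tP k) (r1 k) n.
    by exists (c + d); rewrite FS coefD cE dE rmorphD.
  by exists c => //; rewrite /a /limit_coef cE rmorph_int.
- exact: (limit_radius p_prime FF0 FS r_pos t_low t_le t_ge r_le r_cvg).
- by apply: (limit_transcendental p_prime FF0 FS r_pos t_low t_le t_ge r_le).
- apply/seteqP; split=> [x [[xrho xA] fxA]|x Sx].
    apply: contrapT => nSx.
    (* The pair [(x, f x)] was treated at some step [i]: since then the partial sums
       keep at [x] a distance [d] from [f x], and cannot converge to it. *)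
    have [i prx] := prE (x, ps_eval a x) (conj xA fxA).
    have ax : alpha i = x by rewrite /alpha prx.
    have bx : beta i = ps_eval a x by rewrite /beta prx.
    have Vi : V i by rewrite /V ax.
    pose d := pcabs (val (F i.+1) x - ps_eval a x).
    have d0 : 0 < d by rewrite pcabs_gt0 subr_eq0 -bx -{1}ax FI.
    have dE k : pcabs (val (F (k + i.+1)%N) x - ps_eval a x) = d.
      elim: k => // k IH; rewrite addSn valS addrAC pcabsD_id // -bx -ax.
      by apply: (block_small (tP _)) => //; rewrite leq_addl.
    have [N NP] := F_cvg x xrho d d0.
    by have := NP (N + i.+1)%N (leq_addr _ _); rewrite dE ltxx.
  have [xA xrho] := S_sub Sx; split=> //; have [i six] := sE x Sx.
  suff -> : ps_eval a x = val (F i) x by exact: Qbar_horner.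
  have stable k : val (F (k + i)%N) x = val (F i) x.
    elim: k => // k IH.
    rewrite addSn valS IH /val (block_root (tP _)) ?addr0 //.
    by rewrite -six sL ?leq_addl.
  apply/eqP; rewrite -subr_eq0 -[_ == 0]negbK -pcabs_gt0; apply/negP => d0.
  suff : pcabs (ps_eval a x - val (F i) x) < pcabs (ps_eval a x - val (F i) x).
    by rewrite ltxx.
  apply: (converges_lt (N := i) (F_cvg x xrho)) => n /subnK <-.
  by rewrite stable subrr pcabs0.
move=> n ag; have /eqP := block_diag (tP n); apply.
by rewrite -ag /a (limit_coef_lead p_prime FS t_low t_ge).
Qed.

End Construction.

Theorem theorem1 (R : realType) (p : nat) (p_prime : prime p)
    (K : padicComplexType R p) (rho : \bar R) (rho_gt0 : (0 < rho)%E)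
    (S : set K) (S_sub : S `<=` Qbar `&` open_disk rho)
    (S_conj : closed_under_conjugation S) (S0 : S 0) :
  let good (A : set K) :=
    [set a | [/\ power_series_over A rho a,
                 transcendental_on (open_disk rho) (ps_eval a) &
                 exceptional_set (open_disk rho) (ps_eval a) = S]] in
  ~ countable (good Qset) /\ ((1 <= rho)%E -> ~ countable (good Zset)).
Proof.
move=> good; split=> [|rho1]; apply: uncountable_diagonal => g.
  have [a [[aQ _] ? ? ? ?]] :=
    diagonal_series p_prime rho_gt0 S_sub S_conj S0 g.
  by exists a.
have [a [[_ aZ] ? ? ? ?]] := diagonal_series p_prime rho_gt0 S_sub S_conj S0 g.
by exists a => //; split=> //; split=> //; exact: aZ.
Qed.
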